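(* $\mathbb{DH}[x]$ and $\mathbb{DH}[x,x^c]$ are nested real $\ast$-subalgebras (as well as nested right $\mathbb{DH}$-submodules) of $\mathcal{DS}(\mathbb{DH})$. Moreover, $\mathbb{DH}[x]$ is a real $\ast$-subalgebra and a right $\mathbb{DH}$-submodule of $\mathcal{DSR}(\mathbb{DH})$. Namely, each polynomial $\sum_{\ell,m=0}^n x^\ell(x^c)^m a_{\ell m}$ with $\{a_{\ell m}\}_{\ell,m=0}^n\subset\mathbb{DH}$ is the image through $\mathscr{I}$ of the polynomial stem function $\mathbb{R}_\mathbb{C}\to\mathbb{DH}_\mathbb{C}$, $z\mapsto\sum_{\ell,m=0}^n z^\ell\bar z^m a_{\ell m}$.
   Context: Algebra. $\mathbb{H}$ is the algebra of quaternions with conjugation $x\mapsto x^c$. $\mathbb{DH}=\mathbb{H}+\epsilon\mathbb{H}$ is the algebra of dual quaternions $x=x_1+\epsilon x_2$, with $\epsilon$ central and $\epsilon^2=0$, and $(x_1+\epsilon x_2)^c=x_1^c+\epsilon x_2^c$. A real $\ast$-algebra is a real algebra with an involutive antiautomorphism (here always denoted $^c$). $\mathbb{DR}=\mathbb{R}+\epsilon\mathbb{R}$. $\mathbb{S}_\mathbb{DH}=\{J\in\mathbb{DH}: J+J^c=0,\ JJ^c=1\}$. For $A\in\{\mathbb{R},\mathbb{DR},\mathbb{H},\mathbb{DH}\}$, $A_\mathbb{C}=\{a+e_1b:a,b\in A\}$ with $e_1$ central, $e_1^2=-1$, $\overline{a+e_1b}=a-e_1b$, $(a+e_1b)^c=a^c+e_1b^c$.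 Polynomials. $\mathbb{DH}[x]$ is the set of expressions $\sum_{\ell=0}^n x^\ell a_\ell$ and $\mathbb{DH}[x,x^c]$ the set of expressions $\sum_{\ell,m=0}^n x^\ell(x^c)^ma_{\ell m}$, with $n\in\mathbb{N}$ and coefficients in $\mathbb{DH}$; they are identified with the corresponding functions $\mathbb{DH}\to\mathbb{DH}$. Their $\ast$-algebra operations are $$\Big(\sum x^{\ell}(x^c)^{m}a_{\ell m}\Big)\cdot\Big(\sum x^{\ell}(x^c)^{m}b_{\ell m}\Big)=\sum_{\ell,m}x^\ell(x^c)^m\sum_{s=0}^\ell\sum_{t=0}^m a_{st}b_{\ell-s,m-t},\qquad \Big(\sum x^\ell(x^c)^ma_{\ell m}\Big)^c=\sum x^\ell(x^c)^ma_{\ell m}^c,$$ and similarly on $\mathbb{DH}[x]$ (only powers $(x^c)^0$); addition and right multiplication by elements of $\mathbb{DH}$ act on coefficients. Stem and slice functions on $Q_\mathbb{DH}=\{\alpha+J\beta:\alpha,\beta\in\mathbb{R},J\in\mathbb{S}_\mathbb{DH}\}$. A stem function is $F=F_0+e_1F_1:\mathbb{R}_\mathbb{C}\to\mathbb{DH}_\mathbb{C}$ with $F(\bar z)=\overline{F(z)}$; stem functions form a real $\ast$-algebra and right $\mathbb{DH}$-module under pointwise operations, including $F^c(z)=F(z)^c$. $Stem^{1,0}(\mathbb{R}_\mathbb{C},\mathbb{DH}_\mathbb{C})$ is the set of stem functions $F=G+\epsilon H$ with $G,H$ $\mathbb{H}_\mathbb{C}$-valued stem functions, $G$ of class $C^1$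 and $H$ continuous. $F$ induces $\mathcal{I}(F):Q_\mathbb{DH}\to\mathbb{DH}$, $\mathcal{I}(F)(\alpha+J\beta)=F_0(\alpha+e_1\beta)+JF_1(\alpha+e_1\beta)$ (a slice function), slice regular if $F$ is of class $C^1$ with $\frac{\partial F}{\partial\alpha}+e_1\frac{\partial F}{\partial\beta}=0$. Dual slice functions. Let $F=G+\epsilon H\in Stem^{1,0}(\mathbb{R}_\mathbb{C},\mathbb{DH}_\mathbb{C})$, $G=G_0+e_1G_1$, $H=H_0+e_1H_1$. For $\ell=0,1$, $a=a_1+\epsilon a_2,b=b_1+\epsilon b_2\in\mathbb{DR}$ and $z_1=a_1+e_1b_1$, set $$\check F_\ell(a+e_1b)=G_\ell(z_1)+\epsilon\Big(H_\ell(z_1)+a_2\tfrac{\partial G_\ell}{\partial\alpha}(z_1)+b_2\tfrac{\partial G_\ell}{\partial\beta}(z_1)\Big).$$ Every element of $\mathbb{DH}$ is of the form $a+Ib$ with $a,b\in\mathbb{DR}$, $I\in\mathbb{S}_\mathbb{DH}$, and $\mathscr{I}(F):\mathbb{DH}\to\mathbb{DH}$, $\mathscr{I}(F)(a+Ib)=\check F_0(a+e_1b)+I\check F_1(a+e_1b)$ is well defined and restricts to $\mathcal{I}(F)$ on $Q_\mathbb{DH}$. $\mathcal{DS}(\mathbb{DH})=\mathscr{I}(Stem^{1,0}(\mathbb{R}_\mathbb{C},\mathbb{DH}_\mathbb{C}))$ is the set of dual slice functions on $\mathbb{DH}$; $\mathscr{I}$ is injective. It is a right $\mathbb{DH}$-module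 under pointwise operations, and a real $\ast$-algebra with pointwise addition and with product $\cdot$ and conjugation $^c$ transported via $\mathscr{I}$: $\mathscr{I}(F)\cdot\mathscr{I}(F')=\mathscr{I}(FF')$, $\mathscr{I}(F)^c=\mathscr{I}(F^c)$. $\mathcal{DSR}(\mathbb{DH})$ is the $\ast$-subalgebra of those $\mathscr{I}(F)$ with $\mathcal{I}(F)$ slice regular. *)

(* Defs.v *)
From HB Require Import structures.
From mathcomp Require Import all_boot all_order all_algebra.
From mathcomp Require Import ring.
From mathcomp Require Import boolp classical_sets reals topology normedtype derive.
Set Implicit Arguments.
Unset Strict Implicit.
Unset Printing Implicit Defensive.

Import Order.TTheory GRing.Theory Num.Theory.
Import numFieldNormedType.Exports.
Local Open Scope classical_set_scope.
Local Open Scope ring_scope.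

(* 'rV[R]_4 provides the real vector space structure and the topology of the
   quaternions. *)
Definition quat (R : realType) : Type := 'rV[R]_4.

Section Quaternions.
Variable R : realType.
Local Notation quat := (quat R).

HB.instance Definition _ := NormedModule.copy quat 'rV[R]_4.

Definition mkq (a b c d : R) : quat := \row_(i < 4) [:: a; b; c; d]`_i.

Definition qcoef (x : quat) (k : nat) : R := (x : 'rV[R]_4) ord0 (inord k).

Definition qmul (x y : quat) : quat :=
  let a := qcoef x in let b := qcoef y in
  mkq (a 0 * b 0 - a 1 * b 1 - a 2 * b 2 - a 3 * b 3)
      (a 0 * b 1 + a 1 * b 0 + a 2 * b 3 - a 3 * b 2)
      (a 0 * b 2 - a 1 * b 3 + a 2 * b 0 + a 3 * b 1)
      (a 0 * b 3 + a 1 * b 2 - a 2 * b 1 + a 3 * b 0).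

Definition qconj (x : quat) : quat :=
  mkq (qcoef x 0) (- qcoef x 1) (- qcoef x 2) (- qcoef x 3).

Definition quat_of_real (r : R) : quat := mkq r 0 0 0.

Lemma qcoef_mkq a b c d :
  (qcoef (mkq a b c d) 0 = a) * (qcoef (mkq a b c d) 1 = b) *
  (qcoef (mkq a b c d) 2 = c) * (qcoef (mkq a b c d) 3 = d).
Proof. by rewrite /qcoef !mxE !inordK. Qed.

Lemma qcoefD x y k : qcoef (x + y) k = qcoef x k + qcoef y k.
Proof. by rewrite /qcoef mxE. Qed.

Lemma quatP x y :
  qcoef x 0 = qcoef y 0 -> qcoef x 1 = qcoef y 1 ->
  qcoef x 2 = qcoef y 2 -> qcoef x 3 = qcoef y 3 -> x = y.
Proof.
move=> e0 e1 e2 e3; apply/rowP => i; rewrite -[i]inord_val.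
by case: i => -[|[|[|[|//]]]].
Qed.

Let qmulA : associative qmul.
Proof. by move=> x y z; apply: quatP; rewrite !qcoef_mkq; ring. Qed.

Let qmul1x : left_id (quat_of_real 1) qmul.
Proof. by move=> x; apply: quatP; rewrite !qcoef_mkq; ring. Qed.

Let qmulx1 : right_id (quat_of_real 1) qmul.
Proof. by move=> x; apply: quatP; rewrite !qcoef_mkq; ring. Qed.

Let qmulDl : left_distributive qmul +%R.
Proof.
by move=> x y z; apply: quatP; rewrite qcoefD !qcoef_mkq !qcoefD; ring.
Qed.

Let qmulDr : right_distributive qmul +%R.
Proof.
by move=> x y z; apply: quatP; rewrite qcoefD !qcoef_mkq !qcoefD; ring.
Qed.

Let quat1_neq0 : quat_of_real 1 != 0.
Proof.
apply/eqP => /(congr1 (qcoef^~ 0)) /eqP.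
by rewrite qcoef_mkq /qcoef mxE oner_eq0.
Qed.

HB.instance Definition _ := GRing.Zmodule_isNzRing.Build quat
  qmulA qmul1x qmulx1 qmulDl qmulDr quat1_neq0.

End Quaternions.

(* A + eps A, as pairs with (a, b) standing for a + eps b *)
Definition dual (A : Type) : Type := (A * A)%type.

(* A_C = A + e_1 A, as pairs with (a, b) standing for a + e_1 b *)
Definition cplx (A : Type) : Type := (A * A)%type.

Section Extensions.
Variable A : nzRingType.

HB.instance Definition _ (V : zmodType) := GRing.Zmodule.copy (dual V) (V * V)%type.
HB.instance Definition _ (V : zmodType) := GRing.Zmodule.copy (cplx V) (V * V)%type.

Definition dual_mul (x y : dual A) : dual A := (x.1 * y.1, x.1 * y.2 + x.2 * y.1).

Definition cplx_mul (x y : cplx A) : cplx A :=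
  (x.1 * y.1 - x.2 * y.2, x.1 * y.2 + x.2 * y.1).

Let dual_mulA : associative dual_mul.
Proof.
move=> x y z; rewrite /dual_mul /=.
by congr pair; rewrite ?mulrA// mulrDr mulrDl !mulrA addrA.
Qed.

Let dual_mul1x : left_id ((1, 0) : dual A) dual_mul.
Proof. by case=> a b; rewrite /dual_mul /= !mul1r mul0r addr0. Qed.

Let dual_mulx1 : right_id ((1, 0) : dual A) dual_mul.
Proof. by case=> a b; rewrite /dual_mul /= !mulr1 mulr0 add0r. Qed.

Let dual_mulDl : left_distributive dual_mul +%R.
Proof.
move=> x y z; rewrite /dual_mul /=; congr pair; rewrite /= ?mulrDl//.
by rewrite addrACA.
Qed.

Let dual_mulDr : right_distributive dual_mul +%R.
Proof.
move=> x y z; rewrite /dual_mul /=; congr pair; rewrite /= ?mulrDr//.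
by rewrite addrACA.
Qed.

Let dual1_neq0 : ((1, 0) : dual A) != 0.
Proof. by apply/eqP => -[/eqP]; rewrite oner_eq0. Qed.

HB.instance Definition _ := GRing.Zmodule_isNzRing.Build (dual A)
  dual_mulA dual_mul1x dual_mulx1 dual_mulDl dual_mulDr dual1_neq0.

Let cplx_mulA : associative cplx_mul.
Proof.
move=> x y z; rewrite /cplx_mul /=; congr pair;
  rewrite !(mulrDr, mulrDl, mulrN, mulNr, mulrA, opprD) -!addrA;
  by congr (_ + _); rewrite addrA addrC.
Qed.

Let cplx_mul1x : left_id ((1, 0) : cplx A) cplx_mul.
Proof. by case=> a b; rewrite /cplx_mul /= !mul1r !mul0r subr0 addr0. Qed.

Let cplx_mulx1 : right_id ((1, 0) : cplx A) cplx_mul.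
Proof. by case=> a b; rewrite /cplx_mul /= !mulr1 !mulr0 subr0 add0r. Qed.

Let cplx_mulDl : left_distributive cplx_mul +%R.
Proof.
move=> x y z; rewrite /cplx_mul /=; congr pair; rewrite /= !mulrDl ?opprD;
  by rewrite addrACA.
Qed.

Let cplx_mulDr : right_distributive cplx_mul +%R.
Proof.
move=> x y z; rewrite /cplx_mul /=; congr pair; rewrite /= !mulrDr ?opprD;
  by rewrite addrACA.
Qed.

Let cplx1_neq0 : ((1, 0) : cplx A) != 0.
Proof. by apply/eqP => -[/eqP]; rewrite oner_eq0. Qed.

HB.instance Definition _ := GRing.Zmodule_isNzRing.Build (cplx A)
  cplx_mulA cplx_mul1x cplx_mulx1 cplx_mulDl cplx_mulDr cplx1_neq0.

End Extensions.

Section NormedExtensions.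
Variables (R : realType) (V : normedModType R).

HB.instance Definition _ := NormedModule.copy (dual V) (V * V)%type.
HB.instance Definition _ := NormedModule.copy (cplx V) (V * V)%type.

End NormedExtensions.

Section DualSlice.
Variable R : realType.
Local Notation H := (quat R).
Local Notation DR := (dual R).
Local Notation DH := (dual (quat R)).

Definition cbar (V : zmodType) (z : cplx V) : cplx V := (z.1, - z.2).

Definition dconj (x : DH) : DH := (qconj x.1, qconj x.2).

Definition cconj (w : cplx DH) : cplx DH := (dconj w.1, dconj w.2).

Definition DH_of_DR (a : DR) : DH := (quat_of_real a.1, quat_of_real a.2).

Definition DHC_of_DH (a : DH) : cplx DH := (a, 0).

Definition DHC_of_RC (z : cplx R) : cplx DH :=
  (DH_of_DR (z.1, 0), DH_of_DR (z.2, 0)).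

Definition e1 : cplx DH := (0, 1).

Definition sphereDH : set DH := [set J | J + dconj J = 0 /\ J * dconj J = 1].

Definition partial_alpha (V : normedModType R) (f : cplx R -> V) : cplx R -> V :=
  fun z => 'D_((1, 0) : cplx R) f z.

Definition partial_beta (V : normedModType R) (f : cplx R -> V) : cplx R -> V :=
  fun z => 'D_((0, 1) : cplx R) f z.

Definition classC1 (V : normedModType R) (f : cplx R -> V) : Prop :=
  [/\ forall z, derivable f z ((1, 0) : cplx R),
      forall z, derivable f z ((0, 1) : cplx R),
      continuous (partial_alpha f) & continuous (partial_beta f)].

Definition is_stem (V : zmodType) (F : cplx R -> cplx V) : Prop :=
  forall z, F (cbar z) = cbar (F z).

(* F = G + eps H with G = stem_prim F and H = stem_dual F *)
Definition stem_prim (F : cplx R -> cplx DH) : cplx R -> cplx H :=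
  fun z => ((F z).1.1, (F z).2.1).

Definition stem_dual (F : cplx R -> cplx DH) : cplx R -> cplx H :=
  fun z => ((F z).1.2, (F z).2.2).

(* The equation is componentwise in DH: F is a stem function if and only if
   stem_prim F and stem_dual F are. *)
Definition Stem10 : set (cplx R -> cplx DH) :=
  [set F | [/\ is_stem F, classC1 (stem_prim F) & continuous (stem_dual F)]].

Definition check_ext (g h : cplx R -> H) (w : cplx DR) : DH :=
  let: (a, b) := w in
  let z1 : cplx R := (a.1, b.1) in
  (g z1, h z1 + a.2 *: partial_alpha g z1 + b.2 *: partial_beta g z1).

Definition check0 (F : cplx R -> cplx DH) : cplx DR -> DH :=
  check_ext (fun z => (stem_prim F z).1) (fun z => (stem_dual F z).1).

Definition check1 (F : cplx R -> cplx DH) : cplx DR -> DH :=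
  check_ext (fun z => (stem_prim F z).2) (fun z => (stem_dual F z).2).

Definition is_repr (x : DH) (t : DR * DR * DH) : Prop :=
  let: (a, b, J) := t in
  sphereDH J /\ x = DH_of_DR a + J * DH_of_DR b.

(* Every x has a representation x = a + J b, but not a unique one: for example
   (a, b, J) and (a, - b, - J) both work, and J is arbitrary when b = 0. For F in
   Stem10 the parity of the components of F in beta makes the value independent
   of the representation picked by xget. *)
Definition dslice (F : cplx R -> cplx DH) (x : DH) : DH :=
  let: (a, b, J) := xget (0, 0, 0) (is_repr x) in
  check0 F (a, b) + J * check1 F (a, b).

Definition DS : set (DH -> DH) := [set dslice F | F in Stem10].

(* By definition, F induces a slice regular function on Q_DH when it is of class
   C^1 and satisfies the Cauchy-Riemann equation; this is a condition on F. *)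
Definition stem_regular (F : cplx R -> cplx DH) : Prop :=
  classC1 F /\ forall z, partial_alpha F z + e1 * partial_beta F z = 0.

Definition DSR : set (DH -> DH) :=
  [set dslice F | F in [set F | Stem10 F /\ stem_regular F]].

(* the unique F in Stem10 with dslice F = f, for f in DS *)
Definition stem_of (f : DH -> DH) : cplx R -> cplx DH :=
  xget (fun=> 0) [set F | Stem10 F /\ dslice F = f].

Definition ds_mul (f g : DH -> DH) : DH -> DH :=
  dslice (fun z => stem_of f z * stem_of g z).

Definition ds_conj (f : DH -> DH) : DH -> DH :=
  dslice (fun z => cconj (stem_of f z)).

(* For subsets of DS, whose sum and scalings are pointwise but whose product and
   conjugation are those transported from stem functions *)
Definition real_star_subalgebra (A B : set (DH -> DH)) : Prop :=
  [/\ A `<=` B, A (fun=> 1)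
    & [/\ forall f g, A f -> A g -> A (fun x => f x + g x),
          forall (r : R) f, A f -> A (fun x => r *: f x),
          forall f g, A f -> A g -> A (ds_mul f g)
        & forall f, A f -> A (ds_conj f)]].

Definition right_submodule (A B : set (DH -> DH)) : Prop :=
  [/\ A `<=` B, A (fun=> 0),
      forall f g, A f -> A g -> A (fun x => f x + g x)
    & forall f (c : DH), A f -> A (fun x => f x * c)].

(* DH[x] is {poly DH}, and DH[x, x^c] is {poly {poly DH}} with p`_l`_m the
   coefficient of x^l (x^c)^m: the library's product is the convolution of the
   coefficients. As the coefficients are written on the right, the associated
   functions are not given by Horner evaluation. *)
Definition poly_fun (p : {poly DH}) (x : DH) : DH :=
  \sum_(l < size p) x ^+ l * p`_l.

Definition bipoly_fun (p : {poly {poly DH}}) (x : DH) : DH :=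
  \sum_(l < size p) \sum_(m < size p`_l) x ^+ l * dconj x ^+ m * p`_l`_m.

Definition bipoly_stem (p : {poly {poly DH}}) (z : cplx R) : cplx DH :=
  \sum_(l < size p) \sum_(m < size p`_l)
    DHC_of_RC z ^+ l * DHC_of_RC (cbar z) ^+ m * DHC_of_DH p`_l`_m.

Definition map_bipoly (f : DH -> DH) (p : {poly {poly DH}}) : {poly {poly DH}} :=
  map_poly (map_poly f) p.

(* P is a polynomial algebra, with coefmap f applying f to all coefficients;
   ev identifies its elements with functions. *)
Definition star_embedding (P : nzRingType) (coefmap : (DH -> DH) -> P -> P)
    (ev : P -> DH -> DH) : Prop :=
  [/\ injective ev,
      ev 1 = (fun=> 1),
      forall p q, ev (p + q) = (fun x => ev p x + ev q x),
      forall p q, ev (p * q) = ds_mul (ev p) (ev q)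
    & [/\ forall p, ev (coefmap dconj p) = ds_conj (ev p),
          forall (r : R) p, ev (coefmap ( *:%R r) p) = (fun x => r *: ev p x)
        & forall p (c : DH), ev (coefmap ( *%R^~ c) p) = (fun x => ev p x * c)]].

End DualSlice.

(* Main.v *)
From HB Require Import structures.
Require Import Defs.
From mathcomp Require Import all_boot all_order all_algebra.
From mathcomp Require Import ring.
From mathcomp Require Import boolp classical_sets functions reals topology normedtype derive.
Set Implicit Arguments.
Unset Strict Implicit.
Unset Printing Implicit Defensive.
Import Order.TTheory GRing.Theory Num.Theory.
Import numFieldNormedType.Exports.
Local Open Scope classical_set_scope.
Local Open Scope ring_scope.

(** The restriction of a polynomial sum x^l (x^c)^m a_lm to the slice of an
imaginary unit J is obtained by substituting J for e_1 in the stem polynomial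
sum z^l zbar^m a_lm, because J^2 = -1. The point is that this substitution
remains exact in the dual directions. For dual real a and b, write
a + e_1 b = z + eps v with z and v in R_C. In the dual numbers over R_C, the element
(z + eps v)^l (zbar + eps vbar)^m is the first-order Taylor expansion of
z^l zbar^m at z in the direction v ([jet], [is_cplx_derive_jet]); these are
exactly the terms that occur in the extension of a stem function to dual
arguments. Replacing e_1 by J is a ring morphism from the dual numbers over R_C
to DH ([slice_evalM]) that sends z + eps v to x = a + J b and its conjugate to
x^c. Hence it sends the Taylor expansion to x^l (x^c)^m, and the polynomial
function is the one induced by the polynomial stem function
([bipoly_fun_dslice]), since every dual quaternion is of the form a + J b
([exists_repr]).

A stem function is determined by its slice function ([dslice_inj]): on real
alpha, beta, every representation of alpha + J beta is (alpha, beta, J) or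
(alpha, - beta, - J), up to the choice of J when beta = 0, and the values at J
and - J give both components. So the stem function attached to a polynomial
function is the polynomial one ([stem_of_bipoly]), and the product and
conjugation of slice functions can be computed on polynomial stem functions.
These operations are the formal ones because z and zbar are central in DH_C:
the evaluation of polynomials at them is a ring morphism ([eval2]).

Distinct polynomials induce distinct functions because alpha and beta can be
complexified. In terms of indeterminates X and Y, the stem polynomial is a
polynomial in Z = X + e_1 Y and W = X - e_1 Y. If it vanishes at all real points,
then it vanishes as a polynomial in X and Y. It can then be evaluated at
non-real central values of X and Y for which Z and W are independent reals, so
the original coefficients vanish ([bipoly_stem_eq0]).

The Cauchy-Riemann equation for polynomials in z alone comes from the linearity
over R_C of the derivative of z^l in the direction v ([stem_regular_poly]). *)

(** * Complex and dual scalars acting on dual quaternions *)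

Section CplxComm.
Variable A : comNzRingType.

Lemma cplx_mulC : @commutative (cplx A) (cplx A) *%R.
Proof.
move=> x y; congr pair; rewrite /=; first by rewrite (mulrC x.1) (mulrC x.2).
by rewrite addrC (mulrC x.2) (mulrC x.1).
Qed.

HB.instance Definition _ :=
  GRing.PzRing_hasCommutativeMul.Build (cplx A) cplx_mulC.

End CplxComm.

Section Algebra.
Variable R : realType.
Local Notation H := (quat R).
Local Notation DH := (dual (quat R)).

Lemma quatME (x y : H) : x * y = qmul x y. Proof. by []. Qed.

Lemma qcoefZ (r : R) (x : H) k : qcoef (r *: x) k = r * qcoef x k.
Proof. by rewrite /qcoef mxE. Qed.

Lemma qcoefN (x : H) k : qcoef (- x) k = - qcoef x k.
Proof. by rewrite /qcoef mxE. Qed.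

Lemma qcoef0 k : qcoef (0 : H) k = 0.
Proof. by rewrite /qcoef mxE. Qed.

Definition qcoefE := (qcoef_mkq, qcoefD, qcoefZ, qcoefN, qcoef0).

Lemma quat_of_realMl r (x : H) : quat_of_real r * x = r *: x.
Proof.
by apply: quatP; rewrite !(quatME, qcoefE); ring.
Qed.

Lemma quat_of_realMr r (x : H) : x * quat_of_real r = r *: x.
Proof.
by apply: quatP; rewrite !(quatME, qcoefE); ring.
Qed.

Lemma quat_of_realD r s : quat_of_real (r + s) = quat_of_real r + quat_of_real s :> H.
Proof. by apply: quatP; rewrite !qcoefE ?addr0. Qed.

Lemma quat_of_realN r : quat_of_real (- r) = - quat_of_real r :> H.
Proof. by apply: quatP; rewrite !qcoefE ?oppr0. Qed.

Lemma quat_of_realM r s : quat_of_real (r * s) = quat_of_real r * quat_of_real s :> H.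
Proof. by apply: quatP; rewrite !(quatME, qcoefE); ring. Qed.

Lemma quat_of_real0 : quat_of_real 0 = 0 :> H.
Proof. by apply: quatP; rewrite !qcoefE. Qed.

Lemma DHME (x y : DH) : x * y = (x.1 * y.1, x.1 * y.2 + x.2 * y.1). Proof. by []. Qed.

Local Notation rho := (@DH_of_DR R).

Lemma DH_of_DR_is_zmod_morphism : zmod_morphism rho.
Proof.
by move=> a b; rewrite /DH_of_DR /= !(quat_of_realD, quat_of_realN).
Qed.

Lemma DH_of_DR_is_monoid_morphism : monoid_morphism rho.
Proof.
split; first by rewrite /DH_of_DR /= quat_of_real0.
by move=> a b; rewrite /DH_of_DR /= quat_of_realD !quat_of_realM.
Qed.

HB.instance Definition _ :=
  GRing.isZmodMorphism.Build (dual R) DH rho DH_of_DR_is_zmod_morphism.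
HB.instance Definition _ :=
  GRing.isMonoidMorphism.Build (dual R) DH rho DH_of_DR_is_monoid_morphism.

Lemma DH_of_DR_comm a (x : DH) : rho a * x = x * rho a.
Proof. by rewrite !DHME /= !quat_of_realMl !quat_of_realMr addrC. Qed.

Lemma DH_of_realE r (x : DH) : rho (r, 0) * x = r *: x.
Proof. by rewrite DHME /= !quat_of_realMl scale0r addr0. Qed.

Lemma DH_scaleAr r (x y : DH) : r *: (x * y) = x * (r *: y).
Proof. by rewrite -!DH_of_realE mulrA DH_of_DR_comm mulrA. Qed.

Lemma qconjD (x y : H) : qconj (x + y) = qconj x + qconj y.
Proof. by apply: quatP; rewrite !qcoefE ?opprD. Qed.

Lemma qconj0 : qconj 0 = 0 :> H.
Proof. by apply: quatP; rewrite !qcoefE ?oppr0. Qed.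

Lemma qconjM (x y : H) : qconj (x * y) = qconj y * qconj x.
Proof. by apply: quatP; rewrite !(quatME, qcoefE); ring. Qed.

Lemma qconj_real r : qconj (quat_of_real r) = quat_of_real r :> H.
Proof. by apply: quatP; rewrite !qcoefE ?oppr0. Qed.

Lemma dconjD (x y : DH) : dconj (x + y) = dconj x + dconj y.
Proof. by congr pair; exact: qconjD. Qed.

Lemma dconj0 : dconj 0 = 0 :> DH.
Proof. by congr pair; exact: qconj0. Qed.

Lemma dconjM (x y : DH) : dconj (x * y) = dconj y * dconj x.
Proof. by congr pair; rewrite /= ?qconjD !qconjM // addrC. Qed.

Lemma dconj_DR a : dconj (rho a) = rho a.
Proof. by congr pair; rewrite /= qconj_real. Qed.

Lemma sphereDH_conj (J : DH) : sphereDH J -> dconj J = - J.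
Proof. by case=> /eqP; rewrite addrC addr_eq0 => /eqP. Qed.

Lemma sphereDH_sqr (J : DH) : sphereDH J -> J * J = -1.
Proof.
move=> sJ; have [_ JJ] := sJ; move: JJ; rewrite sphereDH_conj // mulrN.
by move=> <-; rewrite opprK.
Qed.

(** The substitution e_1 := J, from dual numbers with complex entries to DH: the
e_1-free parts of the two entries form one dual real, the e_1-parts another. *)
Definition slice_eval (J : DH) (e : dual (cplx R)) : DH :=
  rho (e.1.1, e.2.1) + J * rho (e.1.2, e.2.2).

Lemma slice_eval1 J : slice_eval J 1 = 1.
Proof.
rewrite /slice_eval /=.
rewrite -[(1, 0)]/(1 : dual R) -[(0, 0)]/(0 : dual R).
by rewrite rmorph1 rmorph0 mulr0 addr0.
Qed.

(** Only J^2 = -1 and the centrality of the dual reals are at stake. *)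
Lemma slice_evalM J (e f : dual (cplx R)) : sphereDH J ->
  slice_eval J (e * f) = slice_eval J e * slice_eval J f.
Proof.
move=> sJ; case: e f => -[a1 b1] [a2 b2] [[c1 d1] [c2 d2]]; rewrite /slice_eval /=.
set a : dual R := (a1, a2); set b : dual R := (b1, b2).
set c : dual R := (c1, c2); set d : dual R := (d1, d2).
have -> : rho (a1 * c1 - b1 * d1, a1 * c2 - b1 * d2 + (a2 * c1 - b2 * d1)) =
          rho (a * c - b * d).
  by congr rho; congr pair; rewrite /= opprD addrACA.
have -> : rho (a1 * d1 + b1 * c1, a1 * d2 + b1 * c2 + (a2 * d1 + b2 * c1)) =
          rho (a * d + b * c).
  by congr rho; congr pair; rewrite /= addrACA.
rewrite rmorphB rmorphD !rmorphM.
rewrite !mulrDr !mulrDl -!mulrA -addrA [RHS]addrACA -!addrA; congr (_ + _).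
rewrite addrC -!addrA (mulrA (rho b)) (DH_of_DR_comm b J) -(mulrA J (rho b)).
rewrite (mulrA J J) (sphereDH_sqr sJ) mulN1r; congr (_ + _).
by rewrite /= (mulrA (rho a) J) (DH_of_DR_comm a J) -mulrA.
Qed.

Lemma slice_evalX J e n : sphereDH J ->
  slice_eval J (e ^+ n) = slice_eval J e ^+ n.
Proof.
move=> sJ; elim: n => [|n IH]; first by rewrite !expr0 slice_eval1.
by rewrite !exprS slice_evalM // IH.
Qed.
End Algebra.

(** * Directional derivatives of complex monomials *)

Section Derivatives.
Variable R : realType.
Local Notation C := (cplx R).

Lemma cvg_is_derive (U V : normedModType R) (f : U -> V) (z v : U) (d : V) :
  h^-1 *: ((f \o shift z) (h *: v) - f z) @[h --> (0 : R)^'] --> d ->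
  is_derive z v f d.
Proof. by move=> fd; split; [exact: cvgP fd | exact: cvg_lim fd]. Qed.

(** The difference quotients of a linear map are constant. *)
Lemma is_derive_linear (U V : normedModType R) (f : {linear U -> V}) (z v : U) :
  is_derive z v f (f v).
Proof.
apply: cvg_is_derive; apply: cvg_near_cst; near=> h.
have -> : (f \o shift z) (h *: v) - f z = h *: f v.
  by rewrite /= linearD -addrA subrr addr0 linearZ.
rewrite scalerA mulVf ?scale1r //.
near: h; exact: nbhs_dnbhs_neq.
Unshelve. all: end_near. Qed.

Lemma is_derive_scaler (U V : normedModType R) (u : U -> R) (a : V) (z v : U) (d : R) :
  is_derive z v u d -> is_derive z v (fun z => u z *: a) (d *: a).
Proof.
case=> du <-; apply: cvg_is_derive.
rewrite (_ : (fun h => _) =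
  (fun h => (h^-1 *: ((u \o shift z) (h *: v) - u z)) *: a)); last first.
  by apply/funext => h; rewrite /= -scalerBl scalerA.
exact: cvgZr_tmp du.
Qed.

(** Complex-valued functions are differentiated componentwise, which gives access
to the calculus of real-valued functions. *)
Definition is_cplx_derive (f : C -> C) (z v d : C) :=
  is_derive z v (fun z => (f z).1) d.1 /\ is_derive z v (fun z => (f z).2) d.2.

Lemma is_cplx_derive_id z v : is_cplx_derive id z v v.
Proof. 
split.
exact: (@is_derive_linear C R fst).
exact: (@is_derive_linear C R snd).
Qed.

Lemma is_cplx_derive_cst (c z v : C) : is_cplx_derive (fun=> c) z v 0.
Proof. by split; exact: is_derive_cst. Qed.

Lemma is_cplx_derive_cbar z v : is_cplx_derive (@cbar R) z v (cbar v).
Proof.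
split; first exact: (@is_derive_linear C R fst).
apply: is_deriveN; exact: (@is_derive_linear C R snd).
Qed.

Lemma is_cplx_deriveM f g z v df dg :
  is_cplx_derive f z v df -> is_cplx_derive g z v dg ->
  is_cplx_derive (fun z => f z * g z) z v (f z * dg + df * g z).
Proof.
move=> [f1 f2] [g1 g2]; split.
  apply: (is_derive_eq (is_deriveB (is_deriveM f1 g1) (is_deriveM f2 g2))).
  by rewrite /= /GRing.scale /=; ring.
apply: (is_derive_eq (is_deriveD (is_deriveM f1 g2) (is_deriveM f2 g1))).
by rewrite /= /GRing.scale /=; ring.
Qed.

(** The power z^l zbar^m evaluated at the dual number z + eps v; its
eps-component is the derivative in the direction v. *)
Definition jet (z v : C) (l m : nat) : dual C :=
  ((z, v) : dual C) ^+ l * ((cbar z, cbar v) : dual C) ^+ m.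

Lemma dual_exprE (A : comNzRingType) (z v : A) n :
  ((z, v) : dual A) ^+ n = (z ^+ n, z ^+ n.-1 *+ n * v).
Proof.
elim: n => [|n IH]; first by rewrite !expr0 mulr0n mul0r.
rewrite exprS IH; congr pair; rewrite /= ?exprS //.
case: n {IH} => [|n]; first by rewrite !expr0 mulr0n !mulr1n mul0r mulr0 add0r mulr1 mul1r.
by rewrite /= mulrA mulrnAr -exprS (mulrC v) -mulrDl -mulrSr.
Qed.

(** Multiplication of dual numbers is the Leibniz rule, so that powers of
f z + eps d carry the derivatives of the powers of f. *)
Lemma is_cplx_derive_expr f z v d n : is_cplx_derive f z v d ->
  is_cplx_derive (fun z => f z ^+ n) z v (((f z, d) : dual C) ^+ n).2.
Proof.
move=> fd; elim: n => [|n IH]; first exact: is_cplx_derive_cst.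
rewrite exprS (_ : (fun z => _) = (fun z => f z * f z ^+ n)); last first.
  by apply/funext => x; rewrite exprS.
have := is_cplx_deriveM fd IH.
by rewrite /= dual_exprE.
Qed.

Lemma jet1 z v l m : (jet z v l m).1 = z ^+ l * cbar z ^+ m.
Proof. by rewrite /jet !dual_exprE. Qed.

(** In this form, the dependence on v is visibly linear and the dependence on z
visibly continuous. *)
Lemma jet2 z v l m : (jet z v l m).2 =
  z ^+ l * (cbar z ^+ m.-1 *+ m * cbar v) + z ^+ l.-1 *+ l * v * cbar z ^+ m.
Proof. by rewrite /jet !dual_exprE. Qed.

Lemma is_cplx_derive_jet z v l m :
  is_cplx_derive (fun z => z ^+ l * cbar z ^+ m) z v (jet z v l m).2.
Proof.
have := is_cplx_deriveM (is_cplx_derive_expr l (is_cplx_derive_id z v))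
  (is_cplx_derive_expr m (is_cplx_derive_cbar z v)).
by rewrite jet2 !dual_exprE.
Qed.

End Derivatives.

(** * Stem polynomials are continuously differentiable *)

Section StemPolynomials.
Variable R : realType.
Local Notation C := (cplx R).
Local Notation H := (quat R).
Local Notation DH := (dual (quat R)).

(** The complex number w acting on the vector a of V, with value in the
complexification of V. *)
Definition cscale (V : lmodType R) (w : C) (a : V) : cplx V := (w.1 *: a, w.2 *: a).

Definition cplx_continuous (T : topologicalType) (f : T -> C) :=
  continuous (fun z => (f z).1) /\ continuous (fun z => (f z).2).

Lemma cplx_continuousD (T : topologicalType) (f g : T -> C) :
  cplx_continuous f -> cplx_continuous g -> cplx_continuous (fun z => f z + g z).
Proof.
move=> [f1 f2] [g1 g2]; split=> z.
  exact: (continuousD (f1 z) (g1 z)).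
exact: (continuousD (f2 z) (g2 z)).
Qed.

Lemma cplx_continuousM (T : topologicalType) (f g : T -> C) :
  cplx_continuous f -> cplx_continuous g -> cplx_continuous (fun z => f z * g z).
Proof.
move=> [f1 f2] [g1 g2]; split=> z.
  exact: (continuousB (continuousM (f1 z) (g1 z)) (continuousM (f2 z) (g2 z))).
exact: (continuousD (continuousM (f1 z) (g2 z)) (continuousM (f2 z) (g1 z))).
Qed.

Lemma cplx_continuous_cst (T : topologicalType) (c : C) : cplx_continuous (fun _ : T => c).
Proof. by split=> z; exact: cvg_cst. Qed.

Lemma cplx_continuousX (T : topologicalType) (f : T -> C) n :
  cplx_continuous f -> cplx_continuous (fun z => f z ^+ n).
Proof.
move=> cf; elim: n => [|n IH]; first exact: cplx_continuous_cst.
rewrite (_ : (fun z => _) = (fun z => f z * f z ^+ n)); last first.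
  by apply/funext => z; rewrite exprS.
exact: cplx_continuousM.
Qed.

Lemma cplx_continuousMn (T : topologicalType) (f : T -> C) n :
  cplx_continuous f -> cplx_continuous (fun z => f z *+ n).
Proof.
move=> cf; rewrite (_ : (fun z => _) = (fun z => f z * n%:R)); last first.
  by apply/funext => z; rewrite mulr_natr.
by apply: cplx_continuousM => //; exact: cplx_continuous_cst.
Qed.

Lemma cplx_continuous_id : cplx_continuous (@id C).
Proof. by split=> z; [exact: cvg_fst|exact: cvg_snd]. Qed.

Lemma cplx_continuous_cbar : cplx_continuous (@cbar R).
Proof. by split=> z; [exact: cvg_fst|apply: continuousN; exact: cvg_snd]. Qed.

Lemma cplx_continuous_jet1 (l m : nat) :
  cplx_continuous (fun z : C => z ^+ l * cbar z ^+ m).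
Proof.
apply: cplx_continuousM; apply: cplx_continuousX;
  [exact: cplx_continuous_id|exact: cplx_continuous_cbar].
Qed.

Lemma cplx_continuous_jet2 (v : C) (l m : nat) :
  cplx_continuous (fun z => (jet z v l m).2).
Proof.
under eq_fun do rewrite jet2.
apply: cplx_continuousD; apply: cplx_continuousM.
- by apply: cplx_continuousX; exact: cplx_continuous_id.
- apply: cplx_continuousM; last exact: cplx_continuous_cst.
  by apply: cplx_continuousMn; apply: cplx_continuousX; exact: cplx_continuous_cbar.
- apply: cplx_continuousM; last exact: cplx_continuous_cst.
  by apply: cplx_continuousMn; apply: cplx_continuousX; exact: cplx_continuous_id.
- by apply: cplx_continuousX; exact: cplx_continuous_cbar.
Qed.

Lemma continuous_cscale (T : topologicalType) (V : normedModType R) (f : T -> C) (a : V) :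
  cplx_continuous f -> continuous (fun z => cscale (f z) a).
Proof.
move=> [f1 f2] z; apply: cvg_pair.
  exact: (@continuousZr_tmp _ _ _ _ a _ (f1 z)).
exact: (@continuousZr_tmp _ _ _ _ a _ (f2 z)).
Qed.

Lemma continuous_bigsum (T : topologicalType) (V : normedModType R) n (h : 'I_n -> T -> V) :
  (forall i, continuous (h i)) -> continuous (fun z => \sum_(i < n) h i z).
Proof.
move=> hc; rewrite (_ : (fun z => _) = \sum_(i < n) h i); last first.
  by apply/funext => z; rewrite fct_sumE.
elim/big_ind: _ => //; first by move=> z; exact: cvg_cst.
by move=> f g cf cg z; exact: (continuousD (cf z) (cg z)).
Qed.

Lemma is_derive_bigsum (U V : normedModType R) n (h : 'I_n -> U -> V) z v d :
  (forall i, is_derive z v (h i) (d i)) ->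
  is_derive z v (fun z => \sum_(i < n) h i z) (\sum_(i < n) d i).
Proof.
move=> hd; rewrite (_ : (fun z => _) = \sum_(i < n) h i); first exact: is_derive_sum.
by apply/funext => x; rewrite fct_sumE.
Qed.

Lemma is_derive_cscale (V : normedModType R) (f : C -> C) (z v d : C) (a : V) :
  is_cplx_derive f z v d -> is_derive z v (fun z => cscale (f z) a) (cscale d a).
Proof.
have cE w : cscale w a = w.1 *: ((a, 0) : cplx V) + w.2 *: ((0, a) : cplx V).
  by congr pair; rewrite /= scaler0 ?addr0 ?add0r.
case=> f1 f2; under eq_fun do rewrite cE.
rewrite cE; exact: is_deriveD (is_derive_scaler _ f1) (is_derive_scaler _ f2).
Qed.

Lemma is_derive_cplx1 (U V : normedModType R) (f : U -> cplx V) z v d :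
  is_derive z v f d -> is_derive z v (fun z => (f z).1) d.1.
Proof.
case=> df <-; apply: cvg_is_derive.
have cf : {for lim (h^-1 *: ((f \o shift z) (h *: v) - f z) @[h --> (0 : R)^']),
    continuous (fst : cplx V -> V)} by exact: cvg_fst.
exact: (cvg_comp _ _ df cf).
Qed.

Lemma is_derive_cplx2 (U V : normedModType R) (f : U -> cplx V) z v d :
  is_derive z v f d -> is_derive z v (fun z => (f z).2) d.2.
Proof.
case=> df <-; apply: cvg_is_derive.
have cf : {for lim (h^-1 *: ((f \o shift z) (h *: v) - f z) @[h --> (0 : R)^']),
    continuous (snd : cplx V -> V)} by exact: cvg_snd.
exact: (cvg_comp _ _ df cf).
Qed.

Variables (V : normedModType R) (n : nat) (k : nat -> nat) (c : nat -> nat -> V).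

(** Polynomial stem functions with coefficients in an arbitrary normed space, so
that the primal part, the dual part and the stem function itself are all
instances. The ragged range of m follows the sizes of the coefficients of a
polynomial in two variables. *)
Definition stem_poly (z : C) : cplx V :=
  \sum_(l < n) \sum_(m < k l) cscale (z ^+ l * cbar z ^+ m) (c l m).

Definition stem_poly_deriv (v z : C) : cplx V :=
  \sum_(l < n) \sum_(m < k l) cscale (jet z v l m).2 (c l m).

Lemma is_derive_stem_poly z v : is_derive z v stem_poly (stem_poly_deriv v z).
Proof.
apply: is_derive_bigsum => l; apply: is_derive_bigsum => m.
exact/is_derive_cscale/is_cplx_derive_jet.
Qed.

Lemma continuous_stem_poly : continuous stem_poly.
Proof.
apply: continuous_bigsum => l; apply: continuous_bigsum => m.
exact/continuous_cscale/cplx_continuous_jet1.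
Qed.

Lemma continuous_stem_poly_deriv v : continuous (stem_poly_deriv v).
Proof.
apply: continuous_bigsum => l; apply: continuous_bigsum => m.
exact/continuous_cscale/cplx_continuous_jet2.
Qed.

Lemma classC1_stem_poly : classC1 stem_poly.
Proof.
split=> [z|z||].
- by have [] := is_derive_stem_poly z (1, 0).
- by have [] := is_derive_stem_poly z (0, 1).
- rewrite (_ : partial_alpha _ = stem_poly_deriv (1, 0)).
    exact: continuous_stem_poly_deriv.
  by apply/funext => z; have [] := is_derive_stem_poly z (1, 0).
- rewrite (_ : partial_beta _ = stem_poly_deriv (0, 1)).
    exact: continuous_stem_poly_deriv.
  by apply/funext => z; have [] := is_derive_stem_poly z (0, 1).
Qed.

End StemPolynomials.

(** * Polynomial stem functions on dual arguments *)

Section SliceEvaluation.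
Variable R : realType.
Local Notation C := (cplx R).
Local Notation H := (quat R).
Local Notation DH := (dual (quat R)).
Local Notation rho := (@DH_of_DR R).
Local Notation iota := (@DHC_of_RC R).

Lemma DH_of_realD s t : rho (s + t, 0) = rho (s, 0) + rho (t, 0).
Proof. by rewrite -(rmorphD rho); apply: congr1; congr pair; rewrite /= addr0. Qed.

Lemma DH_of_realN s : rho (- s, 0) = - rho (s, 0).
Proof. by rewrite -(rmorphN rho); apply: congr1; congr pair; rewrite /= oppr0. Qed.

Lemma DH_of_realM s t : rho (s * t, 0) = rho (s, 0) * rho (t, 0).
Proof.
by rewrite -(rmorphM rho); apply: congr1; congr pair; rewrite /= mulr0 mul0r addr0.
Qed.

Lemma DHC_of_RC_is_zmod_morphism : zmod_morphism iota.
Proof. by move=> z w; congr pair; rewrite /= DH_of_realD DH_of_realN. Qed.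

Lemma DHC_of_RC_is_monoid_morphism : monoid_morphism iota.
Proof.
split.
  congr pair; first exact: (rmorph1 rho).
  exact: (rmorph0 rho).
by move=> z w; congr pair; rewrite /= !(DH_of_realD, DH_of_realN, DH_of_realM).
Qed.

HB.instance Definition _ :=
  GRing.isZmodMorphism.Build C (cplx DH) iota DHC_of_RC_is_zmod_morphism.
HB.instance Definition _ :=
  GRing.isMonoidMorphism.Build C (cplx DH) iota DHC_of_RC_is_monoid_morphism.

(** R_C is central in DH_C, although J does not commute with DH. *)
Lemma DHC_of_RC_comm w (x : cplx DH) : iota w * x = x * iota w.
Proof.
congr pair; rewrite /=; first by rewrite !DH_of_DR_comm.
by rewrite !DH_of_DR_comm addrC.
Qed.

Lemma DHC_of_RC_scale w (a : DH) : iota w * DHC_of_DH a = cscale w a.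
Proof. by congr pair; rewrite /= !mulr0 !DH_of_realE ?subr0 ?add0r. Qed.

Lemma bipoly_stemE (p : {poly {poly DH}}) :
  bipoly_stem p = stem_poly (size p) (fun l => size p`_l) (fun l m => p`_l`_m).
Proof.
apply/funext => z; apply: eq_bigr => l _; apply: eq_bigr => m _.
by rewrite -!rmorphXn -rmorphM DHC_of_RC_scale.
Qed.

Lemma stem_prim_bipoly (p : {poly {poly DH}}) :
  stem_prim (bipoly_stem p) =
  stem_poly (size p) (fun l => size p`_l) (fun l m => (p`_l`_m).1).
Proof.
rewrite bipoly_stemE; apply/funext => z; rewrite /stem_prim /stem_poly.
pose f (w : cplx DH) : cplx H := (w.1.1, w.2.1); rewrite -[LHS]/(f _).
rewrite (big_morph f (id1 := 0) (op1 := +%R)) //; apply: eq_bigr => l _.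
by rewrite (big_morph f (id1 := 0) (op1 := +%R)).
Qed.

Lemma stem_dual_bipoly (p : {poly {poly DH}}) :
  stem_dual (bipoly_stem p) =
  stem_poly (size p) (fun l => size p`_l) (fun l m => (p`_l`_m).2).
Proof.
rewrite bipoly_stemE; apply/funext => z; rewrite /stem_dual /stem_poly.
pose f (w : cplx DH) : cplx H := (w.1.2, w.2.2); rewrite -[LHS]/(f _).
rewrite (big_morph f (id1 := 0) (op1 := +%R)) //; apply: eq_bigr => l _.
by rewrite (big_morph f (id1 := 0) (op1 := +%R)).
Qed.

Lemma cbarD (V : zmodType) : {morph @cbar V : x y / x + y}.
Proof. by move=> x y; congr pair; rewrite /= opprD. Qed.

Lemma cbar0 (V : zmodType) : @cbar V 0 = 0.
Proof. by congr pair; rewrite /= oppr0. Qed.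

Lemma cbarM : {morph @cbar R : x y / x * y}.
Proof. by move=> x y; congr pair; rewrite /=; ring. Qed.

Lemma cbarX n : {morph @cbar R : x / x ^+ n}.
Proof.
move=> x; elim: n => [|n IH]; first by rewrite !expr0 /cbar oppr0.
by rewrite !exprS cbarM IH.
Qed.

Lemma is_stem_bipoly (p : {poly {poly DH}}) : is_stem (bipoly_stem p).
Proof.
move=> z; rewrite bipoly_stemE /stem_poly.
rewrite (big_morph (@cbar DH) (@cbarD DH) (@cbar0 DH)); apply: eq_bigr => l _.
rewrite (big_morph (@cbar DH) (@cbarD DH) (@cbar0 DH)); apply: eq_bigr => m _.
rewrite -!cbarX -cbarM; congr pair; by rewrite /= scaleNr.
Qed.

Lemma Stem10_bipoly (p : {poly {poly DH}}) : Stem10 (bipoly_stem p).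
Proof.
split; first exact: is_stem_bipoly.
  by rewrite stem_prim_bipoly; exact: classC1_stem_poly.
by rewrite stem_dual_bipoly; exact: continuous_stem_poly.
Qed.

(** The derivative in the direction v is the combination of the two partial
derivatives by the components of v, which is how the dual parts enter the
extension of a stem function to dual arguments. *)
Lemma tangent_partial (x y x' y' v : C) :
  x * (y * cbar v) + x' * v * y' =
  v.1 *: (x * (y * cbar (1, 0)) + x' * (1, 0) * y') +
  v.2 *: (x * (y * cbar (0, 1)) + x' * (0, 1) * y').
Proof.
have sE (s t : R) : s *: t = s * t by [].
by congr pair; rewrite /= !sE; ring.
Qed.

Lemma jet2_partial (z v : C) l m :
  (jet z v l m).2 = v.1 *: (jet z (1, 0) l m).2 + v.2 *: (jet z (0, 1) l m).2.
Proof.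
etransitivity; first exact: jet2.
etransitivity; first exact: tangent_partial.
by congr (_ *: _ + _ *: _); apply: esym; exact: jet2.
Qed.

Lemma cplx_sum1 (V : zmodType) n (F : 'I_n -> cplx V) : (\sum_i F i).1 = \sum_i (F i).1.
Proof. exact: (big_morph (fun x : cplx V => x.1) (id1 := 0) (op1 := +%R)). Qed.

Lemma cplx_sum2 (V : zmodType) n (F : 'I_n -> cplx V) : (\sum_i F i).2 = \sum_i (F i).2.
Proof. exact: (big_morph (fun x : cplx V => x.2) (id1 := 0) (op1 := +%R)). Qed.

Lemma dual_sum1 n (F : 'I_n -> DH) : (\sum_i F i).1 = \sum_i (F i).1.
Proof. exact: (big_morph (fun x : DH => x.1) (id1 := 0) (op1 := +%R)). Qed.

Lemma dual_sum2 n (F : 'I_n -> DH) : (\sum_i F i).2 = \sum_i (F i).2.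
Proof. exact: (big_morph (fun x : DH => x.2) (id1 := 0) (op1 := +%R)). Qed.

(** With coefficients in DH on the right, the value and the correction along
the dual part of the argument combine into a single dual real factor for each
monomial. *)
Lemma check_ext_sum (g h : C -> H) (a b : dual R) n (k : nat -> nat)
    (u ua ub : nat -> nat -> R) (A : nat -> nat -> DH) :
  g (a.1, b.1) = \sum_(l < n) \sum_(m < k l) u l m *: (A l m).1 ->
  h (a.1, b.1) = \sum_(l < n) \sum_(m < k l) u l m *: (A l m).2 ->
  partial_alpha g (a.1, b.1) = \sum_(l < n) \sum_(m < k l) ua l m *: (A l m).1 ->
  partial_beta g (a.1, b.1) = \sum_(l < n) \sum_(m < k l) ub l m *: (A l m).1 ->
  check_ext g h (a, b) =
  \sum_(l < n) \sum_(m < k l) rho (u l m, a.2 * ua l m + b.2 * ub l m) * A l m.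
Proof.
move=> gE hE gaE gbE; rewrite /check_ext [RHS]surjective_pairing gE hE gaE gbE.
congr pair.
  rewrite dual_sum1; apply: eq_bigr => l _; rewrite dual_sum1; apply: eq_bigr => m _.
  by rewrite /= quat_of_realMl.
rewrite dual_sum2 !scaler_sumr -!big_split; apply: eq_bigr => l _ /=.
rewrite dual_sum2 !scaler_sumr -!big_split; apply: eq_bigr => m _ /=.
by rewrite !quat_of_realMl scalerDl !scalerA addrA.
Qed.

Lemma slice_eval_jet (J : DH) z v l m : sphereDH J ->
  slice_eval J (jet z v l m) =
  slice_eval J (z, v) ^+ l * slice_eval J (cbar z, cbar v) ^+ m.
Proof. by move=> sJ; rewrite /jet slice_evalM // !slice_evalX. Qed.

Section Check.
Variables (p : {poly {poly DH}}) (a b : dual R).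
Let z : C := (a.1, b.1).
Let v : C := (a.2, b.2).

Let sum_stem1 (V : normedModType R) (w : nat -> nat -> C) (c : nat -> nat -> V) :
  (\sum_(l < size p) \sum_(m < size p`_l) cscale (w l m) (c l m)).1 =
  \sum_(l < size p) \sum_(m < size p`_l) (w l m).1 *: c l m.
Proof. by rewrite cplx_sum1; apply: eq_bigr => l _; rewrite cplx_sum1. Qed.

Let sum_stem2 (V : normedModType R) (w : nat -> nat -> C) (c : nat -> nat -> V) :
  (\sum_(l < size p) \sum_(m < size p`_l) cscale (w l m) (c l m)).2 =
  \sum_(l < size p) \sum_(m < size p`_l) (w l m).2 *: c l m.
Proof. by rewrite cplx_sum2; apply: eq_bigr => l _; rewrite cplx_sum2. Qed.

Lemma check0_bipoly : check0 (bipoly_stem p) (a, b) =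
  \sum_(l < size p) \sum_(m < size p`_l)
    rho ((jet z v l m).1.1, (jet z v l m).2.1) * p`_l`_m.
Proof.
have d u := derive_val (is_derive := is_derive_cplx1 (is_derive_stem_poly
  (size p) (fun l => size p`_l) (fun l m => (p`_l`_m).1) z u)).
rewrite /check0 stem_prim_bipoly stem_dual_bipoly.
etransitivity; first apply: (check_ext_sum (A := fun l m => p`_l`_m) (k := fun l => size p`_l)
  (u := fun l m => (z ^+ l * cbar z ^+ m).1)
  (ua := fun l m => (jet z (1, 0) l m).2.1)
  (ub := fun l m => (jet z (0, 1) l m).2.1)
  (sum_stem1 (fun l m => z ^+ l * cbar z ^+ m) _)
  (sum_stem1 (fun l m => z ^+ l * cbar z ^+ m) _)
  (etrans (d _) (sum_stem1 (fun l m => (jet z (1, 0) l m).2) _))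
  (etrans (d _) (sum_stem1 (fun l m => (jet z (0, 1) l m).2) _))).
apply: eq_bigr => l _; apply: eq_bigr => m _.
congr (_ * _); apply: (congr1 rho); congr pair.
  exact: (congr1 fst (esym (jet1 z v l m))).
exact: (congr1 fst (esym (jet2_partial z v l m))).
Qed.

Lemma check1_bipoly : check1 (bipoly_stem p) (a, b) =
  \sum_(l < size p) \sum_(m < size p`_l)
    rho ((jet z v l m).1.2, (jet z v l m).2.2) * p`_l`_m.
Proof.
have d u := derive_val (is_derive := is_derive_cplx2 (is_derive_stem_poly
  (size p) (fun l => size p`_l) (fun l m => (p`_l`_m).1) z u)).
rewrite /check1 stem_prim_bipoly stem_dual_bipoly.
etransitivity; first apply: (check_ext_sum (A := fun l m => p`_l`_m) (k := fun l => size p`_l)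
  (u := fun l m => (z ^+ l * cbar z ^+ m).2)
  (ua := fun l m => (jet z (1, 0) l m).2.2)
  (ub := fun l m => (jet z (0, 1) l m).2.2)
  (sum_stem2 (fun l m => z ^+ l * cbar z ^+ m) _)
  (sum_stem2 (fun l m => z ^+ l * cbar z ^+ m) _)
  (etrans (d _) (sum_stem2 (fun l m => (jet z (1, 0) l m).2) _))
  (etrans (d _) (sum_stem2 (fun l m => (jet z (0, 1) l m).2) _))).
apply: eq_bigr => l _; apply: eq_bigr => m _.
congr (_ * _); apply: (congr1 rho); congr pair.
  exact: (congr1 snd (esym (jet1 z v l m))).
exact: (congr1 snd (esym (jet2_partial z v l m))).
Qed.

(** The substitution e_1 := J is multiplicative, and maps z + eps v and its
conjugate to a + J b and (a + J b)^c. This holds for every representation of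
the argument, so that independence of the representation comes for free. *)
Lemma bipoly_fun_check (J : DH) : sphereDH J ->
  check0 (bipoly_stem p) (a, b) + J * check1 (bipoly_stem p) (a, b) =
  bipoly_fun p (rho a + J * rho b).
Proof.
move=> sJ; rewrite check0_bipoly check1_bipoly mulr_sumr -big_split.
apply: eq_bigr => l _; rewrite /= mulr_sumr -big_split; apply: eq_bigr => m _ /=.
rewrite mulrA -mulrDl; congr (_ * _).
etransitivity; first exact: (slice_eval_jet z v l m sJ).
congr (_ * _).
congr (_ ^+ _); rewrite dconjD dconjM !dconj_DR sphereDH_conj // mulrN.
rewrite DH_of_DR_comm -mulrN -(rmorphN rho) /slice_eval /z /v /=.
by case: (a) (b) => [? ?] [? ?].
Qed.

End Check.
End SliceEvaluation.

(** * Representations a + J b and injectivity of the slice construction *)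

Section Representation.
Variable R : realType.
Local Notation C := (cplx R).
Local Notation H := (quat R).
Local Notation DH := (dual (quat R)).
Local Notation rho := (@DH_of_DR R).

(** The Euclidean scalar product of the imaginary parts. *)
Definition qdot (x y : H) : R :=
  qcoef x 1 * qcoef y 1 + qcoef x 2 * qcoef y 2 + qcoef x 3 * qcoef y 3.

(** Imaginary units of DH are the tangent vectors to the unit sphere of
imaginary quaternions, a dual number being read as a point with a velocity. *)
Lemma sphereDH_pure (J : DH) : qcoef J.1 0 = 0 -> qcoef J.2 0 = 0 ->
  qdot J.1 J.1 = 1 -> qdot J.1 J.2 = 0 -> sphereDH J.
Proof.
case: J => u w /= u0 w0 uu uw; split.
  by congr pair; apply: quatP; rewrite !qcoefE ?u0 ?w0 ?subrr ?addr0.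
congr pair; apply: quatP; rewrite /= !(quatME, qcoefE) ?u0 ?w0; try ring.
  by rewrite -uu /qdot; ring.
by transitivity (2%:R * qdot u w); [rewrite /qdot; ring | rewrite uw mulr0].
Qed.

Lemma sphereDH_nonempty : exists J : DH, sphereDH J.
Proof.
exists (mkq 0 1 0 0, 0); apply: sphereDH_pure => /=; rewrite /qdot ?qcoefE //.
  by rewrite mulr1 !mulr0 !addr0.
by rewrite !mulr0 !addr0.
Qed.

Lemma pure_polar (y : H) : qcoef y 0 = 0 ->
  exists r u, [/\ y = r *: u, qcoef u 0 = 0 & qdot u u = 1].
Proof.
move=> y0; have yy : 0 <= qdot y y by rewrite /qdot !addr_ge0 // -expr2 sqr_ge0.
have [q0|q0] := eqVneq (qdot y y) 0.
  (* The zero vector has every direction. *)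
  exists 0, (mkq 0 1 0 0); rewrite /qdot !qcoefE scale0r; split=> //; last by ring.
  have sq0 (s : R) : s ^+ 2 = 0 -> s = 0 by move/eqP; rewrite sqrf_eq0 => /eqP.
  have nn (s : R) : 0 <= s * s by rewrite -expr2 sqr_ge0.
  move/eqP: q0; rewrite /qdot !paddr_eq0 ?addr_ge0 // !mulf_eq0 !orbb.
  case/andP => /andP[/eqP y1 /eqP y2] /eqP y3.
  by apply: quatP; rewrite qcoef0.
have r0 : Num.sqrt (qdot y y) != 0 by rewrite sqrtr_eq0 -ltNge lt_neqAle eq_sym q0.
exists (Num.sqrt (qdot y y)), ((Num.sqrt (qdot y y))^-1 *: y); split.
- by rewrite scalerA divff // scale1r.
- by rewrite qcoefZ y0 mulr0.
- have qdotZ t : qdot (t *: y) (t *: y) = t ^+ 2 * qdot y y.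
    by rewrite /qdot !qcoefE; ring.
  by rewrite qdotZ exprVn sqr_sqrtr // mulVf.
Qed.

(** If the imaginary part y = y_1 + eps y_2 has y_1 = n u with n nonzero, then
the dual number n + eps <u, y_2> is its norm and is invertible. If y_1 = 0, then
y = eps y_2 has the direction of y_2. *)
Lemma exists_repr (x : DH) : exists t, is_repr x t.
Proof.
pose im (q : H) : H := q - quat_of_real (qcoef q 0).
have im0 q : qcoef (im q) 0 = 0 by rewrite !qcoefE subrr.
have [n [u [y1E u0 uu]]] := pure_polar (im0 x.1).
pose a : dual R := (qcoef x.1 0, qcoef x.2 0).
suff [b [J [sJ JE]]] : exists b J, sphereDH J /\ (im x.1, im x.2) = J * rho b.
  exists (a, b, J); split=> //; rewrite -JE [LHS]surjective_pairing.
  by congr pair; rewrite /a /im /= addrC subrK.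
have [n0|n0] := eqVneq n 0.
  have [m [u' [y2E u'0 u'u']]] := pure_polar (im0 x.2).
  exists (0, m), (u', 0); split.
    by apply: sphereDH_pure; rewrite /qdot /= ?qcoef0 ?mulr0 ?addr0.
  rewrite y1E n0 y2E; congr pair; rewrite /= !quat_of_realMr ?scaler0 ?scale0r //.
  by rewrite addr0.
pose s := qdot u (im x.2).
(* b is the dual norm of the imaginary part; the dual part of J is the component
   of y_2 orthogonal to u, rescaled by 1 / n. *)
exists (n, s), (u, n^-1 *: (im x.2 - s *: u)); split.
  apply: sphereDH_pure => //=; first by rewrite qcoefZ qcoefD im0 qcoefN qcoefZ u0 mulr0 subr0 mulr0.
  have qdotE w t : qdot u (n^-1 *: (w - t *: u)) = n^-1 * (qdot u w - t * qdot u u).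
    by rewrite /qdot !qcoefE; ring.
  by rewrite qdotE uu mulr1 subrr mulr0.
rewrite y1E; congr pair; rewrite /= !quat_of_realMr // scalerA divff //.
by rewrite scale1r addrC subrK.
Qed.

Lemma bipoly_fun_dslice (p : {poly {poly DH}}) : bipoly_fun p = dslice (bipoly_stem p).
Proof.
apply/funext => x; rewrite /dslice.
have := xgetPex (0, 0, 0) (exists_repr x); case: xget => [[a b] J] [sJ xE].
by rewrite {1}xE; apply: esym; exact: (bipoly_fun_check p a b sJ).
Qed.

Lemma DH_of_DR_inj : injective rho.
Proof.
have rI (r s : R) : quat_of_real r = quat_of_real s -> r = s.
  by move=> /(congr1 (fun q => qcoef q 0)); rewrite !qcoefE.
by move=> [a1 a2] [b1 b2] [/rI -> /rI ->].
Qed.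

Lemma addrr_inj (V : lmodType R) (x y : V) : x + x = y + y -> x = y.
Proof.
have half (z : V) : 2%:R^-1 *: (z + z) = z.
  by rewrite -[z + z]/(z *+ 2) -(scaler_nat 2 z) scalerA mulVf ?scale1r ?pnatr_eq0.
by move=> /(congr1 ( *:%R 2%:R^-1)); rewrite !half.
Qed.

(** The real parts of the two expressions agree, and the squares of the imaginary
parts give b^2 = beta^2 in the dual reals. If beta is nonzero, this forces
b = beta or b = - beta with no dual part. If beta = 0, it only gives b^2 = 0, but
then J' b = 0 and J' is invertible. *)
Lemma repr_real (a b : dual R) (J J' : DH) (al be : R) :
  sphereDH J -> sphereDH J' ->
  rho (al, 0) + J * rho (be, 0) = rho a + J' * rho b ->
  a = (al, 0) /\
  ((b = (be, 0) /\ J' = J) \/ (b = (- be, 0) /\ J' = - J) \/ (b = 0 /\ be = 0)).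
Proof.
have conjJ (I : DH) c : sphereDH I -> dconj (I * rho c) = - (I * rho c).
  by move=> sI; rewrite dconjM dconj_DR sphereDH_conj // mulrN DH_of_DR_comm.
move=> sJ sJ' E.
have aE : a = (al, 0).
  apply/DH_of_DR_inj/addrr_inj.
  have := congr1 (@dconj R) E; rewrite !dconjD !conjJ // !dconj_DR => Ec.
  have := congr2 +%R E Ec.
  by rewrite addrACA subrr addr0 addrACA subrr addr0.
split=> //; move: E; rewrite aE => /addrI E.
have sq (I : DH) c : sphereDH I -> (I * rho c) * (I * rho c) = rho (- (c * c)).
  move=> sI; rewrite -mulrA (mulrA (rho c)) DH_of_DR_comm -mulrA mulrA.
  by rewrite sphereDH_sqr // mulN1r rmorphN rmorphM.
have := congr2 *%R E E; rewrite !sq // => /DH_of_DR_inj /oppr_inj; case: b aE E => b1 b2 aE E.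
case; rewrite /= mulr0 mul0r addr0 => /eqP; rewrite -!expr2 eqf_sqr => /orP b1E b2E.
have [be0|be0] := eqVneq be 0.
  right; right; split=> //.
  have b10 : b1 = 0 by case: b1E => /eqP; rewrite be0 ?oppr0 // => /esym/eqP; rewrite ?oppr_eq0 => /eqP.
  have : rho (b1, b2) = rho 0.
    have : J' * (J' * rho (b1, b2)) = 0.
      rewrite -E be0 -[(0, 0)]/(0 : dual R).
      by rewrite (rmorph0 rho) !mulr0.
    rewrite mulrA (sphereDH_sqr sJ') mulN1r => /eqP.
    by rewrite oppr_eq0 => /eqP ->; rewrite (rmorph0 rho).
  by move/DH_of_DR_inj.
have b20 : b2 = 0.
  have b10 : b1 != 0.
    by case: b1E => /eqP b1E; move: be0; rewrite b1E ?oppr_eq0.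
  move/esym/eqP: b2E; rewrite mulrC -mulr2n mulrn_eq0 /= mulf_eq0 (negPf b10) orbF.
  by move/eqP.
have canc (I I' : DH) : I * rho (be, 0) = I' * rho (be, 0) -> I = I'.
  rewrite -!DH_of_DR_comm !DH_of_realE => /(congr1 ( *:%R be^-1)).
  by rewrite !scalerA mulVf // !scale1r.
case: b1E => /eqP b1E; rewrite b20 in E *.
  by left; rewrite b1E; split=> //; apply: canc; rewrite E b1E.
right; left; have b1E' : b1 = - be by rewrite b1E opprK.
split; first by rewrite b1E'.
apply: canc; rewrite mulNr E b1E'.
by rewrite -mulrN -rmorphN; congr (_ * rho _); congr pair; rewrite /= ?opprK ?oppr0.
Qed.

Lemma check_ext_real (g h : C -> H) al be :
  check_ext g h ((al, 0), (be, 0)) = (g (al, be), h (al, be)).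
Proof. by rewrite /check_ext /= !scale0r !addr0. Qed.

(** The different representations give the same value because the two components
of a stem function are respectively even and odd in beta. *)
Lemma dslice_real (F : C -> cplx DH) (J : DH) (al be : R) :
  is_stem F -> sphereDH J ->
  dslice F (rho (al, 0) + J * rho (be, 0)) = (F (al, be)).1 + J * (F (al, be)).2.
Proof.
move=> sF sJ; rewrite /dslice.
have := xgetPex (0, 0, 0) (exists_repr (rho (al, 0) + J * rho (be, 0))).
case: xget => [[a b] J'] [sJ' /(repr_real sJ sJ')] [-> E].
have c0 s : check0 F ((al, 0), (s, 0)) = (F (al, s)).1.
  by rewrite /check0 check_ext_real /= -surjective_pairing.
have c1 s : check1 F ((al, 0), (s, 0)) = (F (al, s)).2.
  by rewrite /check1 check_ext_real /= -surjective_pairing.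
case: E => [[-> ->]|[[-> ->]|[-> be0]]]; rewrite c0 c1 //.
  by rewrite (sF (al, be)) /= mulrNN.
have F0 : (F (al, 0)).2 = 0.
  have /(congr1 snd) /= := sF (al, 0); rewrite /cbar /= oppr0.
  by move=> F0; apply: addrr_inj; rewrite {1}F0 addNr addr0.
by rewrite be0 F0 !mulr0.
Qed.

(** Comparing alpha + J beta and alpha - J beta separates the two components. *)
Lemma dslice_inj (F F' : C -> cplx DH) : is_stem F -> is_stem F' ->
  dslice F = dslice F' -> F = F'.
Proof.
move=> sF sF' E; apply/funext => -[al be].
have [J sJ] := sphereDH_nonempty.
have E1 s : (F (al, s)).1 + J * (F (al, s)).2 = (F' (al, s)).1 + J * (F' (al, s)).2.
  apply: etrans (dslice_real _ _ sF' sJ); rewrite -E.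
  exact: esym (dslice_real _ _ sF sJ).
have E2 : (F (al, be)).1 - J * (F (al, be)).2 = (F' (al, be)).1 - J * (F' (al, be)).2.
  by have := E1 (- be); rewrite (sF (al, be)) (sF' (al, be)) /= !mulrN.
have e1 : (F (al, be)).1 = (F' (al, be)).1.
  have := congr2 +%R (E1 be) E2.
  by rewrite addrACA subrr addr0 addrACA subrr addr0 => /addrr_inj.
have e2 : (F (al, be)).2 = (F' (al, be)).2.
  have := E1 be; rewrite e1 => /addrI /(congr1 ( *%R J)).
  by rewrite !mulrA (sphereDH_sqr sJ) !mulN1r => /oppr_inj.
by rewrite [LHS]surjective_pairing e1 e2 -surjective_pairing.
Qed.
End Representation.

(** * Evaluation of polynomials at central elements *)

Section BivariateEvaluation.
Variables (A B : nzRingType) (f : {rmorphism A -> B}) (u v : B).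
Hypotheses (uC : forall x, GRing.comm u x) (vC : forall x, GRing.comm v x).

Let inner_comm : commr_rmorph f v. Proof. by move=> x; exact: vC. Qed.
Definition eval_inner : {rmorphism {poly A} -> B} := horner_morph inner_comm.

Let outer_comm : commr_rmorph eval_inner u. Proof. by move=> x; exact: uC. Qed.
(** Evaluation of the outer variable at u and of the inner variable at v. It is a
ring morphism because u and v are central, even though the coefficients do not
commute. *)
Definition eval2 : {rmorphism {poly {poly A}} -> B} := horner_morph outer_comm.

Lemma eval_innerE q : eval_inner q = \sum_(m < size q) v ^+ m * f q`_m.
Proof.
rewrite /eval_inner /= /horner_morph (horner_coef_wide _ (size_poly _ _)).
by apply: eq_bigr => m _; rewrite coef_map /=; apply: commrX; apply: commr_sym; exact: vC.
Qed.

Lemma eval2E p :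
  eval2 p = \sum_(l < size p) \sum_(m < size p`_l) u ^+ l * v ^+ m * f p`_l`_m.
Proof.
rewrite /eval2 /= /horner_morph (horner_coef_wide _ (size_poly _ _)).
apply: eq_bigr => l _; rewrite coef_poly ltn_ord.
transitivity (u ^+ l * eval_inner p`_l).
  by apply: commrX; apply: commr_sym; exact: uC.
by rewrite eval_innerE mulr_sumr; apply: eq_bigr => m _; rewrite mulrA.
Qed.

Lemma eval2X : eval2 'X = u. Proof. exact: horner_morphX. Qed.

Lemma eval2XC : eval2 'X%:P = v.
Proof. by rewrite /eval2 /= horner_morphC /= horner_morphX. Qed.

Lemma eval2CC c : eval2 c%:P%:P = f c.
Proof. by rewrite /eval2 /= horner_morphC /= horner_morphC. Qed.

End BivariateEvaluation.

Section PolynomialStems.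
Variable R : realType.
Local Notation C := (cplx R).
Local Notation DH := (dual (quat R)).
Local Notation B := (cplx DH).
Local Notation iota := (@DHC_of_RC R).

Lemma DHC_of_DH_is_zmod_morphism : zmod_morphism (@DHC_of_DH R).
Proof. by move=> a b; congr pair; rewrite /= subrr. Qed.

Lemma DHC_of_DH_is_monoid_morphism : monoid_morphism (@DHC_of_DH R).
Proof. by split=> // a b; congr pair; rewrite /= ?mulr0 ?mul0r ?subr0 ?addr0. Qed.

HB.instance Definition _ :=
  GRing.isZmodMorphism.Build DH B (@DHC_of_DH R) DHC_of_DH_is_zmod_morphism.
HB.instance Definition _ :=
  GRing.isMonoidMorphism.Build DH B (@DHC_of_DH R) DHC_of_DH_is_monoid_morphism.

Lemma iota_comm w x : GRing.comm (iota w) x. Proof. exact: DHC_of_RC_comm. Qed.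

Lemma e1E : e1 R = iota (0, 1).
Proof.
by congr pair; [exact: esym (rmorph0 (@DH_of_DR R))|exact: esym (rmorph1 (@DH_of_DR R))].
Qed.

Lemma bipoly_stem_eval2 (p : {poly {poly DH}}) z :
  bipoly_stem p z = eval2 (@DHC_of_DH R) (iota_comm z) (iota_comm (cbar z)) p.
Proof. by rewrite eval2E. Qed.

Lemma bipoly_stemM (p q : {poly {poly DH}}) z :
  bipoly_stem (p * q) z = bipoly_stem p z * bipoly_stem q z.
Proof. by rewrite !bipoly_stem_eval2 rmorphM. Qed.

Local Notation real r := (iota (r, 0)).

Lemma real_sub_reg (r s : R) (x : B) : r != s -> x * (real r - real s) = 0 -> x = 0.
Proof.
move=> rs; rewrite -rmorphB => x0.
have: x * real (r - s) * real ((r - s)^-1) = 0.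
  rewrite (_ : real (r - s) = iota ((r, 0) - (s, 0))) ?x0 ?mul0r //.
  by apply: congr1; congr pair; rewrite /= subr0.
rewrite -mulrA -rmorphM.
have -> : ((r - s, 0) : C) * ((r - s)^-1, 0) = 1; last by rewrite rmorph1 mulr1.
by congr pair; rewrite /= !(mul0r, mulr0, subr0, addr0) // divff // subr_eq0.
Qed.

(** Real numbers are central and their nonzero differences are invertible, so
that one linear factor can be divided out after another as over a field; the
integers provide enough roots. *)
Lemma poly_real_roots (p : {poly B}) : (forall r, p.[real r] = 0) -> p = 0.
Proof.
move=> p0; suff gen n (q : {poly B}) a : (size q <= n)%N ->
    (forall k, (a <= k)%N -> q.[real k%:R] = 0) -> q = 0.
  exact: (gen (size p) p 0).
elim: n q a => [|n IH] q a; first by rewrite leqn0 size_poly_eq0 => /eqP.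
move=> qn q0; have /factor_theorem[q' qE] : root q (real a%:R).
  by apply/rootP/q0.
have [q'0|q'0] := eqVneq q' 0; first by rewrite qE q'0 mul0r.
have q'n : (size q' <= n)%N.
  by move: qn; rewrite qE size_Mmonic ?monicXsubC // size_XsubC addn2.
rewrite qE (IH q' a.+1 q'n) ?mul0r // => k ak.
apply: (@real_sub_reg k%:R a%:R); first by rewrite eqr_nat gtn_eqF.
rewrite -(q0 k (ltnW ak)) qE hornerM_comm; first by rewrite hornerXsubC.
exact: iota_comm.
Qed.

Lemma eval2_real_inj (A : nzRingType) (f : {rmorphism A -> B}) (p : {poly {poly A}}) :
  injective f ->
  (forall r s, eval2 f (iota_comm (r, 0)) (iota_comm (s, 0)) p = 0) -> p = 0.
Proof.
move=> fI p0; apply/polyP => l; apply/polyP => m; rewrite !coef0.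
apply: fI; rewrite rmorph0.
suff E : map_poly f p`_l = 0 by have := coef_map f p`_l m; rewrite E coef0 => <-.
apply: poly_real_roots => s.
suff E : map_poly (eval_inner f (iota_comm (s, 0))) p = 0.
  by have := coef_map (eval_inner f (iota_comm (s, 0))) p l; rewrite E coef0 => /esym.
by apply: poly_real_roots => r; exact: (p0 r s).
Qed.

(** The relation is transported to a polynomial G in the indeterminates X and
Y of the real and imaginary parts, and then read at non-real values of these. *)
Lemma bipoly_stem_eq0 (p : {poly {poly DH}}) : (forall z, bipoly_stem p z = 0) -> p = 0.
Proof.
move=> p0.
pose Y : {poly {poly B}} := ((e1 R)%:P * 'X)%:P.
(* The outer indeterminate stands for alpha and the inner one for beta. *)
pose Z : {poly {poly B}} := 'X + Y.
pose W : {poly {poly B}} := 'X - Y.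
pose G := \sum_(l < size p) \sum_(m < size p`_l)
  Z ^+ l * W ^+ m * (DHC_of_DH p`_l`_m)%:P%:P.
have EG (E : {rmorphism {poly {poly B}} -> B}) z w : (forall c, E c%:P%:P = c) ->
    E 'X + e1 R * E 'X%:P = iota z -> E 'X - e1 R * E 'X%:P = iota w ->
    E G = eval2 (@DHC_of_DH R) (iota_comm z) (iota_comm w) p.
  move=> EC zE wE; have EY : E Y = e1 R * E 'X%:P by rewrite /Y polyCM rmorphM EC.
  rewrite [RHS]eval2E /G rmorph_sum; apply: eq_bigr => l _.
  rewrite rmorph_sum; apply: eq_bigr => m _.
  rewrite rmorphM EC; congr (_ * _); rewrite rmorphM; congr (_ * _).
    by rewrite rmorphXn /Z rmorphD EY zE.
  by rewrite rmorphXn /W rmorphB EY wE.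
have G0 : G = 0.
  apply: (@eval2_real_inj _ idfun) => [//|r s].
  rewrite (EG _ (r, s) (cbar (r, s))) ?eval2X ?eval2XC.
  - by rewrite -bipoly_stem_eval2.
  - by move=> c; rewrite eval2CC.
  - by rewrite e1E -rmorphM -rmorphD; apply: congr1; congr pair; rewrite /=; ring.
  - by rewrite e1E -rmorphM -rmorphB; apply: congr1; congr pair; rewrite /=; ring.
apply: (@eval2_real_inj _ (@DHC_of_DH R)) => [x y [] //|r s].
(* X = (r + s) / 2 and e_1 Y = (r - s) / 2, so that Z = r and W = s. *)
pose E := eval2 idfun (iota_comm ((r + s) / 2%:R, 0)) (iota_comm (0, (s - r) / 2%:R)).
rewrite -(EG E) ?/E ?eval2X ?eval2XC.
- by rewrite G0 rmorph0.
- by move=> c; rewrite eval2CC.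
- by rewrite e1E -rmorphM -rmorphD; apply: congr1; congr pair; rewrite /=; field.
- by rewrite e1E -rmorphM -rmorphB; apply: congr1; congr pair; rewrite /=; field.
Qed.

Lemma bipoly_stem_inj : injective (@bipoly_stem R).
Proof.
move=> p q E; apply/eqP; rewrite -subr_eq0; apply/eqP; apply: bipoly_stem_eq0 => z.
by rewrite bipoly_stem_eval2 rmorphB -!bipoly_stem_eval2 E subrr.
Qed.

Lemma cscale_CR (w w' : C) (c : DH) :
  w + ((0, 1) : C) * w' = 0 -> cscale w c + e1 R * cscale w' c = 0.
Proof.
move=> w0; transitivity (iota (w + ((0, 1) : C) * w') * DHC_of_DH c).
  by rewrite rmorphD rmorphM mulrDl -mulrA !DHC_of_RC_scale e1E.
by rewrite w0 rmorph0 mul0r.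
Qed.

Lemma stem_regular_poly (p : {poly DH}) : stem_regular (bipoly_stem (p ^:P)).
Proof.
rewrite bipoly_stemE; split; first exact: classC1_stem_poly.
move=> z; rewrite /partial_alpha /partial_beta.
rewrite !(derive_val (is_derive := is_derive_stem_poly _ _ _ _ _)) /stem_poly_deriv.
rewrite mulr_sumr -big_split big1 // => l _; rewrite /= mulr_sumr -big_split big1 // => m _ /=.
have sz1 : leq (size (p ^:P)`_l) 1 by rewrite coef_map size_polyC_leq1.
have -> : nat_of_ord m = 0%N.
  by apply/eqP; rewrite -leqn0 -ltnS; exact: leq_trans (ltn_ord m) sz1.
apply: cscale_CR.
apply: etrans (congr2 (fun a b : C => a + ((0, 1) : C) * b) (jet2 _ _ _ _) (jet2 _ _ _ _)) _.
rewrite mulr0n; move: (_ ^+ l) (_ *+ l) (_ ^+ 0) => x y t.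
by congr pair; rewrite /=; ring.
Qed.

End PolynomialStems.

(** * Polynomial functions as a subalgebra of dual slice functions *)

Section CoefficientSums.
Variable D : nzRingType.

(** Polynomial functions, polynomial stem functions and their images by additive
maps are all sums of this shape. *)
Definition bisum (V : nmodType) (g : nat -> nat -> D -> V) (p : {poly {poly D}}) : V :=
  \sum_(l < size p) \sum_(m < size p`_l) g l m p`_l`_m.

(** The sizes of sums and images of polynomials are not determined by those of
the arguments, so that the sums have to be compared over a common square
range. *)
Definition bidegree_bound (n : nat) (p : {poly {poly D}}) : Prop :=
  leq (size p) n /\ forall l, leq (size p`_l) n.

Lemma exists_bidegree_bound (s : seq {poly {poly D}}) :
  exists n, forall p, p \in s -> bidegree_bound n p.
Proof.
elim: s => [|p s [n bn]]; first by exists 0%N.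
pose np := maxn (size p) (\max_(l < size p) size (p`_l)%R).
exists (maxn np n) => q; rewrite inE => /predU1P[->|/bn[qn cn]]; last first.
  by split=> [|l]; rewrite leq_max ?qn ?cn orbT.
split=> [|l]; first by rewrite /np !leq_max leqnn.
have [lp|lp] := ltnP l (size p); last by rewrite nth_default ?size_poly0.
by rewrite /np !leq_max (leq_bigmax (Ordinal lp)) orbT.
Qed.

Lemma bisum_wide (V : nmodType) (g : nat -> nat -> D -> V) n p :
  (forall l m, g l m 0 = 0) -> bidegree_bound n p ->
  bisum g p = \sum_(l < n) \sum_(m < n) g l m p`_l`_m.
Proof.
move=> g0 [pn cn]; rewrite /bisum.
rewrite (big_ord_widen n (fun l => \sum_(m < size p`_l) g l m p`_l`_m) pn).
rewrite big_mkcond; apply: eq_bigr => l _.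
case: ltnP => [_|lp]; last first.
  by rewrite big1 // => m _; rewrite (nth_default 0 lp) coef0 g0.
rewrite (big_ord_widen n (fun m => g l m p`_l`_m) (cn l)).
rewrite big_mkcond; apply: eq_bigr => m _.
by case: ltnP => // mp; rewrite nth_default.
Qed.

Lemma bisumD (V : nmodType) (g : nat -> nat -> D -> V) p q :
  (forall l m, g l m 0 = 0) -> (forall l m, {morph g l m : a b / a + b}) ->
  bisum g (p + q) = bisum g p + bisum g q.
Proof.
move=> g0 gD; have [n bn] := exists_bidegree_bound [:: p; q; p + q].
rewrite !(@bisum_wide _ _ n) //; try by apply: bn; rewrite !inE eqxx ?orbT.
rewrite -big_split; apply: eq_bigr => l _ /=; rewrite -big_split; apply: eq_bigr => m _.
by rewrite !coefD gD.
Qed.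

Lemma bisum_map (V : nmodType) (g : nat -> nat -> D -> V) (f : D -> D) p :
  (forall l m, g l m 0 = 0) -> f 0 = 0 ->
  bisum g (map_poly (map_poly f) p) = bisum (fun l m a => g l m (f a)) p.
Proof.
move=> g0 f0; have [n bn] := exists_bidegree_bound [:: p; map_poly (map_poly f) p].
rewrite !(@bisum_wide _ _ n) //; try by apply: bn; rewrite !inE eqxx ?orbT.
  2: by move=> l m; rewrite f0.
apply: eq_bigr => l _; apply: eq_bigr => m _.
by rewrite coef_map_id0 ?map_poly0 // coef_map_id0.
Qed.

Lemma map_bipolyC (f : D -> D) (p : {poly D}) : f 0 = 0 ->
  map_poly (map_poly f) (p ^:P) = (map_poly f p) ^:P.
Proof.
move=> f0; apply/polyP => l; rewrite coef_map_id0 ?map_poly0 // !coef_map /=.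
apply/polyP => m; rewrite coef_map_id0 // !coefC coef_map_id0 //.
by case: ifP.
Qed.

End CoefficientSums.

Section Main.
Variable R : realType.
Local Notation DH := (dual (quat R)).

Lemma bipoly_fun_polyC (p : {poly DH}) : bipoly_fun (p ^:P) = poly_fun p.
Proof.
apply/funext => x; rewrite /bipoly_fun /poly_fun size_map_polyC.
apply: eq_bigr => l _; rewrite coef_map /= size_polyC.
have [->|_] := eqVneq p`_l 0; first by rewrite big_ord0 mulr0.
by rewrite big_ord1 expr0 mulr1 coefC.
Qed.

Lemma stem_of_bipoly (p : {poly {poly DH}}) : stem_of (bipoly_fun p) = bipoly_stem p.
Proof.
apply: xget_unique; first by split; [exact: Stem10_bipoly|rewrite bipoly_fun_dslice].
move=> F [[sF _ _] FE]; apply: (dslice_inj sF (is_stem_bipoly p)).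
by rewrite FE; exact: bipoly_fun_dslice.
Qed.

Lemma bipoly_fun_inj : injective (@bipoly_fun R).
Proof. by move=> p q E; apply: bipoly_stem_inj; rewrite -!stem_of_bipoly E. Qed.

Lemma bipoly_funM (p q : {poly {poly DH}}) :
  bipoly_fun (p * q) = ds_mul (bipoly_fun p) (bipoly_fun q).
Proof.
rewrite /ds_mul !stem_of_bipoly bipoly_fun_dslice; congr dslice.
by apply/funext => z; exact: bipoly_stemM.
Qed.

(** The conjugation of DH_C reverses products but fixes the powers of z and zbar,
which are central. *)
Lemma cconj_bipoly_stem (p : {poly {poly DH}}) z :
  cconj (bipoly_stem p z) = bipoly_stem (map_bipoly (@dconj R) p) z.
Proof.
have cconjD : {morph @cconj R : x y / x + y}.
  by move=> x y; congr pair; exact: dconjD.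
have cconj0 : cconj 0 = 0 :> cplx DH by congr pair; exact: dconj0.
pose g l m a := DHC_of_RC z ^+ l * DHC_of_RC (cbar z) ^+ m * DHC_of_DH a.
transitivity (bisum (fun l m a => cconj (g l m a)) p).
  rewrite (big_morph _ cconjD cconj0); apply: eq_bigr => l _.
  by rewrite (big_morph _ cconjD cconj0).
transitivity (bisum (fun l m a => g l m (dconj a)) p).
  apply: eq_bigr => l _; apply: eq_bigr => m _.
  rewrite /g -!rmorphXn -rmorphM !DHC_of_RC_scale.
  have dconjZ (r : R) (x : DH) : dconj (r *: x) = r *: dconj x.
    by rewrite -!DH_of_realE dconjM dconj_DR DH_of_DR_comm.
  by congr pair; rewrite /= dconjZ.
apply: esym; apply: bisum_map; last exact: dconj0.
by move=> l m; rewrite /g rmorph0 mulr0.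
Qed.

Lemma bipoly_fun_conj (p : {poly {poly DH}}) :
  bipoly_fun (map_bipoly (@dconj R) p) = ds_conj (bipoly_fun p).
Proof.
rewrite /ds_conj stem_of_bipoly bipoly_fun_dslice; congr dslice.
by apply/funext => z; rewrite cconj_bipoly_stem.
Qed.

Lemma bipoly_funD (p q : {poly {poly DH}}) :
  bipoly_fun (p + q) = (fun x => bipoly_fun p x + bipoly_fun q x).
Proof.
apply/funext => x; apply: (bisumD (g := fun l m a => x ^+ l * dconj x ^+ m * a)).
  by move=> l m; rewrite mulr0.
by move=> l m a b; rewrite mulrDr.
Qed.

Lemma bipoly_fun_scale (r : R) (p : {poly {poly DH}}) :
  bipoly_fun (map_bipoly ( *:%R r) p) = (fun x => r *: bipoly_fun p x).
Proof.
apply/funext => x.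
apply: etrans (bisum_map (g := fun l m a => x ^+ l * dconj x ^+ m * a) p _ _) _.
- by move=> l m; rewrite mulr0.
- exact: scaler0.
rewrite scaler_sumr; apply: eq_bigr => l _; rewrite scaler_sumr; apply: eq_bigr => m _.
by rewrite DH_scaleAr.
Qed.

Lemma bipoly_fun_mulr (c : DH) (p : {poly {poly DH}}) :
  bipoly_fun (map_bipoly ( *%R^~ c) p) = (fun x => bipoly_fun p x * c).
Proof.
apply/funext => x.
apply: etrans (bisum_map (g := fun l m a => x ^+ l * dconj x ^+ m * a) p _ _) _.
- by move=> l m; rewrite mulr0.
- exact: mul0r.
rewrite mulr_suml; apply: eq_bigr => l _; rewrite mulr_suml; apply: eq_bigr => m _.
by rewrite mulrA.
Qed.

Lemma poly_fun1 : poly_fun (1 : {poly DH}) = (fun=> 1).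
Proof.
apply/funext => x; rewrite /poly_fun size_poly1 big_ord1 expr0 mul1r.
by rewrite coef1.
Qed.

Lemma star_embedding_bipoly : star_embedding (@map_bipoly R) (@bipoly_fun R).
Proof.
split; [exact: bipoly_fun_inj| |exact: bipoly_funD|exact: bipoly_funM|].
  by rewrite -poly_fun1 -bipoly_fun_polyC rmorph1.
by split; [exact: bipoly_fun_conj|exact: bipoly_fun_scale
  |move=> p c; exact: bipoly_fun_mulr].
Qed.

Lemma star_embedding_poly : star_embedding (fun f => map_poly f) (@poly_fun R).
Proof.
split.
- move=> p q; rewrite -!bipoly_fun_polyC => /bipoly_fun_inj.
  exact: (map_inj_poly polyC_inj (polyC0 _)).
- exact: poly_fun1.
- by move=> p q; rewrite -!bipoly_fun_polyC rmorphD bipoly_funD.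
- by move=> p q; rewrite -!bipoly_fun_polyC rmorphM bipoly_funM.
- split=> [p|r p|p c]; rewrite -!bipoly_fun_polyC -map_bipolyC.
  + exact: bipoly_fun_conj.
  + exact: dconj0.
  + exact: bipoly_fun_scale.
  + exact: scaler0.
  + exact: bipoly_fun_mulr.
  + exact: mul0r.
Qed.

Section Range.
Variables (P : nzRingType) (cm : (DH -> DH) -> P -> P) (ev : P -> DH -> DH).
Variable B : set (DH -> DH).
Hypotheses (evE : star_embedding cm ev) (evB : range ev `<=` B).

Lemma real_star_subalgebra_range : real_star_subalgebra (range ev) B.
Proof.
have [_ ev1 evD evM [evC evZ _]] := evE; split=> //; first by exists 1.
split=> [f g [p _ <-] [q _ <-]|r f [p _ <-]|f g [p _ <-] [q _ <-]|f [p _ <-]].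
- by exists (p + q).
- by exists (cm ( *:%R r) p).
- by exists (p * q).
- by exists (cm (@dconj R) p).
Qed.

Lemma right_submodule_range : right_submodule (range ev) B.
Proof.
have [_ ev1 evD evM [_ _ evR]] := evE; split=> //.
- exists (cm ( *%R^~ 0) 1) => //; rewrite evR.
  by apply/funext => x; rewrite mulr0.
- by move=> f g [p _ <-] [q _ <-]; exists (p + q).
- by move=> f c [p _ <-]; exists (cm ( *%R^~ c) p).
Qed.

End Range.

Lemma range_poly_bipoly : range (@poly_fun R) `<=` range (@bipoly_fun R).
Proof. by move=> _ [p _ <-]; exists (p ^:P) => //; exact: bipoly_fun_polyC. Qed.

Lemma range_bipoly_DS : range (@bipoly_fun R) `<=` @DS R.
Proof.
move=> _ [p _ <-]; exists (bipoly_stem p); first exact: Stem10_bipoly.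
by rewrite bipoly_fun_dslice.
Qed.

Lemma range_poly_DSR : range (@poly_fun R) `<=` @DSR R.
Proof.
move=> _ [p _ <-]; exists (bipoly_stem (p ^:P)).
  by split; [exact: Stem10_bipoly|exact: stem_regular_poly].
by rewrite -bipoly_fun_dslice bipoly_fun_polyC.
Qed.

End Main.

Theorem theorem8p1 (R : realType) :
  let DHx := range (@poly_fun R) in
  let DHxxc := range (@bipoly_fun R) in
  [/\ [/\ star_embedding (fun f => map_poly f) (@poly_fun R),
          star_embedding (@map_bipoly R) (@bipoly_fun R)
        & forall p : {poly dual (quat R)}, bipoly_fun (p ^:P) = poly_fun p],
      [/\ real_star_subalgebra DHx DHxxc, real_star_subalgebra DHx (@DS R)
        & real_star_subalgebra DHxxc (@DS R)],
      [/\ right_submodule DHx DHxxc, right_submodule DHx (@DS R)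
        & right_submodule DHxxc (@DS R)],
      real_star_subalgebra DHx (@DSR R) /\ right_submodule DHx (@DSR R)
    & forall p : {poly {poly dual (quat R)}},
        Stem10 (bipoly_stem p) /\ bipoly_fun p = dslice (bipoly_stem p)].
Proof.
have pE := star_embedding_poly R; have bE := star_embedding_bipoly R.
have pb := @range_poly_bipoly R; have bS := @range_bipoly_DS R.
have pS := subset_trans pb bS; have pR := @range_poly_DSR R.
move=> DHx DHxxc; split.
- by split=> //; exact: bipoly_fun_polyC.
- by split; [exact: real_star_subalgebra_range pE pb
  |exact: real_star_subalgebra_range pE pS|exact: real_star_subalgebra_range bE bS].
- by split; [exact: right_submodule_range pE pb
  |exact: right_submodule_range pE pS|exact: right_submodule_range bE bS].
- by split; [exact: real_star_subalgebra_range pE pR|exact: right_submodule_range pE pR].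
- by move=> p; split; [exact: Stem10_bipoly|exact: bipoly_fun_dslice].
Qed.
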